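(* Let $n,j\in\mathbb{Z}^+$ and let $G$ be a $j$-regular simple graph. If $n \nmid (j+1)$, then $\chi_{n}(G) = \chi(G)$.
   Context: A $\mathbb{Z}$-labeling of $G=(V,E)$ is a map $\ell:V\to\mathbb{Z}$; its order is the size of its range; it is proper if adjacent vertices get different labels; $\chi(G)$ is the minimum order of a proper labeling. $N[v]$ is the closed neighborhood of $v$. A closed coloring with nonzero remainders mod $n$ is a labeling with $\sum_{w\in N[v]}\ell(w)\not\equiv 0 \pmod n$ for all $v\in V$. If no proper such coloring exists, $\chi_n(G)$ does not exist; otherwise $\chi_n(G)$ is the minimum order of a proper closed coloring with nonzero remainders mod $n$ if one of finite order exists, and $\chi_n(G)=\infty$ otherwise. *)

(* Defs.v *)
From mathcomp Require Import all_boot all_order all_algebra.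
From mathcomp Require Import all_classical.

Set Implicit Arguments.
Unset Strict Implicit.
Unset Printing Implicit Defensive.

Import GRing.Theory.
Local Open Scope classical_set_scope.
Local Open Scope card_scope.
Local Open Scope ring_scope.

(* The vertex set may be infinite. *)
Record sgraph := SGraph {
  vertex :> choiceType;
  adj : vertex -> vertex -> Prop;
  adj_sym : forall u v, adj u v -> adj v u;
  adj_irrefl : forall v, ~ adj v v
}.

Definition open_nbhd (G : sgraph) (v : G) : set G := [set w | adj v w].

Definition closed_nbhd (G : sgraph) (v : G) : set G := v |` open_nbhd v.

Definition regular (G : sgraph) (j : nat) : Prop :=
  forall v : G, open_nbhd v #= `I_j.

Definition labeling (G : sgraph) := G -> int.

Definition has_order (G : sgraph) (l : labeling G) (k : nat) : Prop :=
  range l #= `I_k.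

Definition proper (G : sgraph) (l : labeling G) : Prop :=
  forall u v : G, adj u v -> l u <> l v.

(* The sum is the genuine one as soon as closed_nbhd v is finite; over a set on
   which l has infinite support, the library's finitely supported sum is 0. *)
Definition closed_sum (G : sgraph) (l : labeling G) (v : G) : int :=
  \sum_(w \in closed_nbhd v) l w.

Definition closed_coloring_mod (n : nat) (G : sgraph) (l : labeling G) : Prop :=
  forall v : G, (closed_sum l v != 0 %[mod n])%Z.

Inductive enat := Fin of nat | Infty.

(* Infty when no labeling in P has finite order. *)
Definition min_order (G : sgraph) (P : set (labeling G)) : enat :=
  if pselect (exists k, `[< exists2 l, P l & has_order l k >]) is left ex
  then Fin (ex_minn ex) else Infty.

Definition chi (G : sgraph) : enat := min_order [set l : labeling G | proper l].

Definition proper_closed_coloring (n : nat) (G : sgraph) (l : labeling G) :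
  Prop := proper l /\ closed_coloring_mod n l.

(* None encodes that chi_n(G) does not exist. *)
Definition chi_mod (n : nat) (G : sgraph) : option enat :=
  if `[< exists l : labeling G, proper_closed_coloring n l >]
  then Some (min_order [set l : labeling G | proper_closed_coloring n l])
  else None.

(* Main.v *)
(** Affinely relabel: if [l] is proper then so is [1 + n l], it has the same
    order, and its sum over any closed neighbourhood is congruent to [j + 1]
    modulo [n].  So every order attained by a proper labeling is attained by a
    proper closed coloring.  Some proper labeling exists even when [G] is
    infinite, because the connected components of [G] are countable. *)

From mathcomp Require Import all_boot.
From mathcomp Require Import all_order all_algebra finmap.
From mathcomp Require Import all_classical.
Require Import Defs.

Set Implicit Arguments.
Unset Strict Implicit.
Unset Printing Implicit Defensive.

Import GRing.Theory.

Lemma eq_min_order (G : sgraph) (P Q : set (labeling G)) :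
    (forall k, (exists2 l, P l & has_order l k) <->
               (exists2 l, Q l & has_order l k)) ->
  min_order P = min_order Q.
Proof.
move=> PQ.
(* [ex_minn] depends on its existence proof; as a function of the predicate alone, the minimum can
   be compared by extensionality. *)
pose least (p : pred nat) :=
  if pselect (exists k, p k) is left ex then Fin (ex_minn ex) else Infty.
change (least (fun k => `[< exists2 l, P l & has_order l k >]) =
        least (fun k => `[< exists2 l, Q l & has_order l k >])).
by congr least; apply/funext => k; congr asbool; apply/propext.
Qed.

(* Fix a root in each component and enumerate the neighbours of each vertex;
   label a vertex by the code of an index sequence leading to it from its root.
   The label determines the vertex within its component. *)
Lemma locally_countable_proper (G : sgraph) :
    (forall v : G, countable (open_nbhd v)) ->
  exists l : labeling G, proper l.
Proof.
move=> cntG.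
have [[v0 _]|G0] := pselect (exists v : G, True); last first.
  by exists (fun=> 0%R) => u; case: G0; exists u.
have /choice[nb nbP] (v : G) :
    exists g : nat -> G, forall w, adj v w -> exists i, g i = w.
  have /countable_injP[f f_inj] := cntG v.
  exists (fun i => xget v0 [set w | adj v w /\ f w = i]%classic) => w vw.
  exists (f w); case: xgetP => [x _ [vx fx]|/(_ w)]; last by case.
  by apply: f_inj => //; apply/mem_set.
(* Jumps to the default [v0] can make this larger than the component of [v]; all that matters is
   that it contains [v] and is the same for adjacent vertices, so that they share a root. *)
pose ancestors v := [set r | exists s, foldl nb r s = v]%classic.
have sub_ancestors u v : adj u v -> (ancestors u `<=` ancestors v)%classic.
  move=> /nbP[i ui] r [s rs]; exists (rcons s i).
  by rewrite -cats1 foldl_cat rs.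
pose root v := xget v0 (ancestors v).
have rootP v : exists s, foldl nb (root v) s = v.
  rewrite /root; case: xgetP => [//|/(_ v)] no_root.
  by case: no_root; exists [::].
have /choice[code codeP] := rootP.
exists (fun v => Posz (choice.pickle (code v))) => u v uv.
case=> /(pcan_inj choice.pickleK) eq_code.
have eq_root : root u = root v.
  congr (xget v0 _); apply/seteqP.
  by split; apply: sub_ancestors => //; apply: adj_sym.
apply: (@adj_irrefl G v).
by rewrite -{1}(codeP v) -eq_code -eq_root codeP.
Qed.

Section AffineRelabeling.
Local Open Scope ring_scope.

Variables (n : nat) (G : sgraph).

Definition affine_labeling (l : labeling G) : labeling G :=
  fun v => 1 + n%:Z * l v.

Lemma affine_inj : (0 < n)%N -> injective (fun x : int => 1 + n%:Z * x).
Proof.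
by move=> n0 x y /addrI/mulfI; apply; rewrite -lt0n.
Qed.

Lemma affine_proper l : (0 < n)%N -> proper l -> proper (affine_labeling l).
Proof. by move=> n0 pl u v /pl luv /(affine_inj n0). Qed.

Lemma affine_has_order l k :
  (0 < n)%N -> has_order l k -> has_order (affine_labeling l) k.
Proof.
move=> n0; rewrite /has_order => lk.
have -> : range (affine_labeling l) =
          ((fun x => 1 + n%:Z * x) @` range l)%classic by rewrite image_comp.
by apply: card_eq_trans lk; apply: inj_card_eq; apply: in2W (affine_inj n0).
Qed.

Lemma affine_closed_sum l j v : regular G j ->
  closed_sum (affine_labeling l) v = j.+1%:Z + n%:Z * closed_sum l v.
Proof.
move=> /(_ v) Gj.
have fin_nbhd : finite_set (open_nbhd v) by exists j.
have fin_closed : finite_set (closed_nbhd v) by rewrite finite_setU.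
(* The summand 1 is counted once per vertex: [j] neighbours and, as there are no loops, [v] itself
   as a further one. *)
have card_closed : #|` fset_set (closed_nbhd v)| = j.+1.
  rewrite fset_setU1// cardfsU1 (card_fset_set Gj) in_fset_set// memNset//.
  exact: adj_irrefl.
rewrite /closed_sum !fsbig_finite//= big_split/= -mulr_sumr; congr (_ + _).
by rewrite big_const_seq count_predT card_closed iter_addr_0 natz.
Qed.

Lemma affine_closed_coloring l j : regular G j -> ~~ (n %| j.+1)%N ->
  closed_coloring_mod n (affine_labeling l).
Proof.
move=> Gj nj v; rewrite (affine_closed_sum _ _ Gj).
by rewrite addrC mulrC modzMDl mod0z modz_nat.
Qed.

End AffineRelabeling.

Theorem theorem3p4 (n j : nat) (G : sgraph) :
  0 < n -> 0 < j -> regular G j -> ~~ (n %| j.+1) ->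
  chi_mod n G = Some (chi G).
Proof.
move=> n0 _ Gj nj.
have affineP (l : labeling G) :
    proper l -> proper_closed_coloring n (affine_labeling n l).
  move=> pl; split; first exact: affine_proper.
  exact: affine_closed_coloring _ Gj nj.
(* This excludes the value [None]. The range of [l] may be infinite: if no finite order occurs, both
   minima are [Infty]. *)
have [l pl] : exists l : labeling G, proper l.
  by apply: locally_countable_proper => v; apply: finite_set_countable; exists j.
rewrite /chi_mod asboolT; last by exists (affine_labeling n l); apply: affineP.
congr Some; apply: eq_min_order => k; split=> -[m].
  by case=> pm _ mk; exists m.
move=> pm mk; exists (affine_labeling n m); first exact: affineP.
exact: affine_has_order.
Qed.
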